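(* Let $e>0$, $\tau>0$, $\bar h>0$ and $g>0$. If $g<\dfrac{e^2}{2\bar h}$, then the 2-dimensional 7-velocity (D2Q7) lattice Boltzmann model for the shallow water equations is stable at the constant state $f_*=f^{eq}(\bar h,\mathbf 0)$, in the sense of the stability structure defined in the context (with $d=2$, $N=7$).
   Context: **Discrete-velocity Boltzmann equation.** For velocities $\boldsymbol\xi_0,\dots,\boldsymbol\xi_{N-1}\in\mathbb R^d$, consider the system $$\frac{\partial f_i}{\partial t}+\boldsymbol\xi_i\cdot\nabla f_i=J_i(f),\qquad i=0,1,\dots,N-1,$$ for $f=(f_0,\dots,f_{N-1})^T$, with $J(f)=(J_0(f),\dots,J_{N-1}(f))^T$. Let $J_f(f)\in\mathbb R^{N\times N}$ denote the Jacobian matrix of $J$ with respect to $f$. **Stability structure (definition).** Let $f_*$ be a constant state with $J(f_* )=0$. The system is called stable at $f_*$ if there is an invertible matrix $P\in\mathbb R^{N\times N}$ such that $P^TP$ is diagonal, $P^TP=\mathrm{diag}(a_1,\dots,a_N)$, and $$P\,J_f(f_* )=-\mathrm{diag}(\lambda_1,\dots,\lambda_N)\,P$$ with $\lambda_i=0$ for $i\le d+1$ and $\lambda_i>0$ for $i>d+1$. **The D2Q7 model.** Here $d=2$, $N=7$, $e>0$ is the lattice speed, $g$ is the (reduced) gravity, $\tau>0$ is the relaxation time, $\boldsymbol\xi_0=(0,0)$ and $$\boldsymbol\xi_i=e\left(\cos\tfrac{(i-1)\pi}{3},\ \sin\tfrac{(i-1)\pi}{3}\right),\qquad i=1,\dots,6.$$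 For $f$ with $\sum_i f_i>0$, the water depth $h$ and velocity $\mathbf u\in\mathbb R^2$ are defined by $h=\sum_{i=0}^6 f_i$, $h\mathbf u=\sum_{i=0}^6\boldsymbol\xi_i f_i$. The collision term is $$J_i(f)=\frac{f_i^{eq}(h,\mathbf u)-f_i}{\tau},$$ where $h,\mathbf u$ are the functions of $f$ just given and $$f_i^{eq}(h,\mathbf u)=\begin{cases}h-\dfrac{gh^2}{e^2}+\dfrac{h|\mathbf u|^2}{e^2}, & i=0,\\[2ex]\dfrac{gh^2}{6e^2}+\dfrac{h\,\boldsymbol\xi_i\cdot\mathbf u}{3e^2}+\dfrac{2h(\boldsymbol\xi_i\cdot\mathbf u)^2}{3e^4}-\dfrac{h|\mathbf u|^2}{2e^2}, & i=1,\dots,6.\end{cases}$$ *)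

(* Defs.v *)
From HB Require Import structures.
From mathcomp Require Import all_boot all_order all_algebra.
From mathcomp Require Import all_classical all_reals all_analysis.
Set Implicit Arguments.
Unset Strict Implicit.
Unset Printing Implicit Defensive.
Import Order.TTheory GRing.Theory Num.Theory.
Import numFieldNormedType.Exports.
Local Open Scope ring_scope.

(* Data of the system
     d_t f_i + velocity i . grad f_i = collision_i (f),   i < N,
   in space dimension d. A state f is a row vector. *)
Record discrete_velocity_model (R : realType) (d N : nat) := DVModel {
  velocity : 'I_N -> 'rV[R]_d;
  collision : 'rV[R]_N -> 'rV[R]_N
}.

(* The library's Jacobian acts on row vectors from the right, so that its
   (j, i) entry is d F_i / d f_j; the transpose is the usual matrix, whose
   (i, j) entry is d F_i / d f_j. *)
Definition jacobian_matrix (R : realType) (N : nat) (F : 'rV[R]_N -> 'rV[R]_N)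
    (f : 'rV[R]_N) : 'M[R]_N :=
  (jacobian F f)^T.

(* Indices start at 0 here: i < d.+1 selects the first d + 1 of the lambda's.
   Differentiability is required because the library's Jacobian is a total
   operator that is meaningless at other points. *)
Definition stable_at (R : realType) (d N : nat)
    (M : discrete_velocity_model R d N) (fs : 'rV[R]_N) : Prop :=
  [/\ collision M fs = 0,
      differentiable (collision M) fs &
      exists (P : 'M[R]_N) (a lambda : 'rV[R]_N),
        [/\ P \in unitmx,
            P^T *m P = diag_mx a,
            P *m jacobian_matrix (collision M) fs = - diag_mx lambda *m P,
            forall i : 'I_N, (i < d.+1)%N -> lambda 0 i = 0 &
            forall i : 'I_N, (d.+1 <= i)%N -> 0 < lambda 0 i]].

Definition dotv (R : realType) (d : nat) (u v : 'rV[R]_d) : R :=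
  \sum_(k < d) u 0 k * v 0 k.

Section D2Q7.
Variable R : realType.
Implicit Types (e g tau h : R) (u : 'rV[R]_2) (f : 'rV[R]_7).

Definition d2q7_velocity e (i : 'I_7) : 'rV[R]_2 :=
  if i == 0 then 0
  else let theta := (i.-1)%:R * pi / 3 in
       e *: \row_(k < 2) (if k == 0 then cos theta else sin theta).

Definition water_depth f : R := \sum_(i < 7) f 0 i.

(* Only meaningful when water_depth f != 0. *)
Definition water_velocity e f : 'rV[R]_2 :=
  (water_depth f)^-1 *: \sum_(i < 7) f 0 i *: d2q7_velocity e i.

Definition d2q7_equilibrium e g h u : 'rV[R]_7 :=
  \row_(i < 7)
    if i == 0 then
      h - g * h ^+ 2 / e ^+ 2 + h * dotv u u / e ^+ 2
    else
      g * h ^+ 2 / (6 * e ^+ 2)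
      + h * dotv (d2q7_velocity e i) u / (3 * e ^+ 2)
      + 2 * h * dotv (d2q7_velocity e i) u ^+ 2 / (3 * e ^+ 4)
      - h * dotv u u / (2 * e ^+ 2).

Definition d2q7_collision e g tau f : 'rV[R]_7 :=
  tau^-1 *: (d2q7_equilibrium e g (water_depth f) (water_velocity e f) - f).

Definition d2q7 e g tau : discrete_velocity_model R 2 7 :=
  DVModel (d2q7_velocity e) (d2q7_collision e g tau).

End D2Q7.

(* Main.v *)
Require Import Defs.
From HB Require Import structures.
From mathcomp Require Import all_boot all_order all_algebra.
From mathcomp Require Import all_classical all_reals all_analysis.
From mathcomp Require Import ring lra.
Import Order.TTheory GRing.Theory Num.Theory.
Import numFieldNormedType.Exports.
Local Open Scope ring_scope.

(* At the rest state the collision Jacobian is (A - 1) / tau with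
   A i j = w i + (xi_i . xi_j) / (3 e^2), where w 0 = 1 - 2 c, w i = c / 3 and
   c = g h / e^2. The velocity moments of order at most one are left
   eigenvectors of A for the eigenvalue 1. They extend to a basis B of modes
   that is orthogonal for the weights w, and A kills the four others. The
   condition g < e^2 / (2 h) says exactly that w 0 > 0, so that the modes can
   be normalized. The normalized matrix P satisfies P diag(w) P^T = 1, hence
   P^T P = diag(w)^-1. *)

(** * Symmetrizers built from weighted orthogonal eigenvectors *)

Section OrthogonalModes.
Context {R : rcfType} {N : nat}.
Implicit Types (B J : 'M[R]_N) (w n l : 'rV[R]_N).

Lemma orthogonal_modes_symmetrizer B J w n l :
  (forall i, 0 < w 0 i) -> (forall k, 0 < n 0 k) ->
  B *m diag_mx w *m B^T = diag_mx n -> B *m J = - diag_mx l *m B ->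
  exists (P : 'M[R]_N) (a : 'rV[R]_N),
    [/\ P \in unitmx, P^T *m P = diag_mx a & P *m J = - diag_mx l *m P].
Proof.
move=> w_gt0 n_gt0 BwB BJ.
pose s : 'rV[R]_N := \row_k (Num.sqrt (n 0 k))^-1.
pose P := diag_mx s *m B; pose a : 'rV[R]_N := \row_i (w 0 i)^-1.
have PwP : P *m (diag_mx w *m P^T) = 1%:M.
  rewrite /P trmx_mul tr_diag_mx !mulmxA -(mulmxA (diag_mx s)).
  rewrite -(mulmxA (diag_mx s)) BwB !mulmx_diag -diag_const_mx; congr diag_mx.
  apply/rowP => k; rewrite !mxE.
  have nk := n_gt0 k; rewrite -{2}(sqr_sqrtr (ltW nk)) expr2 mulrA mulVf.
    by rewrite mul1r mulfV// gt_eqF// sqrtr_gt0.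
  by rewrite gt_eqF// sqrtr_gt0.
have aw : diag_mx a *m diag_mx w = 1%:M.
  rewrite mulmx_diag -diag_const_mx; congr diag_mx; apply/rowP => i.
  by rewrite !mxE mulVf// gt_eqF.
exists P, a; split.
- by case: (mulmx1_unit PwP).
(* A one-sided inverse of a square matrix is two-sided, so [diag_mx w *m P^T *m P = 1]. *)
- have := mulmx1C PwP => /(congr1 (mulmx (diag_mx a))).
  by rewrite mulmx1 !mulmxA aw mul1mx.
- by rewrite /P -mulmxA BJ !mulmxA mulmxN !mulNmx diag_mxC.
Qed.

End OrthogonalModes.

(** * Differentials of functions of depth and velocity *)

Section Differentials.
Context {R : realType} {V : normedModType R}.
Implicit Types (f df : V -> R) (x : V).

Lemma is_diff_sum {W : normedModType R} n (F dF : 'I_n -> V -> W) x :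
  (forall i, is_diff x (F i) (dF i)) ->
  is_diff x (\sum_(i < n) F i) (\sum_(i < n) dF i).
Proof.
move=> dFP; elim/big_ind2 : _ => [|f1 d1 f2 d2|i _]; last exact: dFP.
  exact: is_diff_cst.
exact: is_diffD.
Qed.

Lemma is_diff_row n (F dF : V -> 'rV[R]_n) x :
  (forall i, is_diff x (fun y => F y 0 i : R) (fun y => dF y 0 i : R)) ->
  is_diff x F dF.
Proof.
move=> dFP.
have rowE (G : V -> 'rV[R]_n) :
    G = \sum_(i < n) (fun y => G y 0 i *: delta_mx 0 i).
  by apply/funext => y; rewrite fct_sumE [LHS]row_sum_delta.
rewrite [F]rowE [dF]rowE; apply: is_diff_sum => i.
exact: (is_diff_comp (dFP i) (is_diff_scalel _ _)).
Qed.

Lemma is_diff_inv {f df x} : is_diff x f df -> f x != 0 ->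
  is_diff x (fun y => (f y)^-1) (fun v => - (f x) ^- 2 * df v).
Proof.
move=> dfx fx0; apply: DiffDef; first exact: differentiableV.
by rewrite diffV// diff_val.
Qed.

(* Products of two velocity components have a zero differential at rest. *)
Lemma is_diff_shallow_water {f df} {u0 u1 du0 du1 : V -> R} {x}
    (a b c0 c1 p q r : R) :
  is_diff x f df -> is_diff x u0 du0 -> is_diff x u1 du1 ->
  u0 x = 0 -> u1 x = 0 ->
  is_diff x (fun y => a * f y + b * f y ^+ 2 + f y * (c0 * u0 y + c1 * u1 y)
                      + f y * (p * u0 y ^+ 2 + q * (u0 y * u1 y) + r * u1 y ^+ 2))
            (fun v => (a + 2 * b * f x) * df v
                      + f x * (c0 * du0 v + c1 * du1 v)).
Proof.
move=> dfx du0x du1x u0x u1x.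
rewrite (_ : (fun y => _) = a *: f + b *: (f * f) + f * (c0 *: u0 + c1 *: u1)
  + f * (p *: (u0 * u0) + q *: (u0 * u1) + r *: (u1 * u1))); last first.
  by apply/funext => y.
have quad_diff := is_diffD (is_diffD (is_diffZ p (is_diffM du0x du0x))
  (is_diffZ q (is_diffM du0x du1x))) (is_diffZ r (is_diffM du1x du1x)).
have lin_diff := is_diffD (is_diffZ c0 du0x) (is_diffZ c1 du1x).
have depth_diff := is_diffD (is_diffZ a dfx) (is_diffZ b (is_diffM dfx dfx)).
have diff := is_diffD (is_diffD depth_diff (is_diffM dfx lin_diff))
  (is_diffM dfx quad_diff).
apply: (is_diff_eq diff); apply/funext => v.
rewrite !fctE /= u0x u1x /GRing.scale /=; ring.
Qed.

End Differentials.

(** A continuous linear form is its own differential; the linear structure is packed by hand because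
    [diff_lin] takes a bundled map. *)
Lemma is_diff_coord {R : realType} {n} (M : 'rV[R]_n) i :
  is_diff M (fun A : 'rV[R]_n => A 0 i : R) (fun A => A 0 i).
Proof.
apply: DiffDef; first exact: differentiable_coord.
pose f (A : 'rV[R]_n) : R := A 0 i.
have f_lin : linear f by move=> k A B; rewrite /f !mxE.
pose fM := GRing.isLinear.Build _ _ _ _ _ f_lin.
pose fL : {linear _ -> _} := HB.pack f fM.
by have := @diff_lin _ _ _ fL M (coord_continuous (i:=0) (j:=i)).
Qed.

(** * Geometry of the hexagon and its orthogonal modes *)

Section HexagonalLattice.
Context {R : realType}.
Implicit Types (c e : R).

(** With [t = pi / 3], the angles [2 t] and [t] add up to [pi], so [cos t] is a root of
    [2 x^2 + x - 1 = (2 x - 1) (x + 1)]; positivity excludes [-1]. *)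
Lemma cos_pi3 : cos (pi / 3) = 2^-1 :> R.
Proof.
have pi0 := pi_gt0 R; pose t : R := pi / 3.
have : cos (t *+ 2) = - cos t.
  by rewrite -cosDpi -(cosN (t + pi)) -(cosD2pi (- _)); congr cos; rewrite /t; field.
rewrite cos_mulr2n => dbl.
have cos_gt0 : 0 < cos t by apply: cos_gt0_pihalf; rewrite /t; lra.
have : (cos t - 2^-1) * (cos t + 1) = 0 by move: dbl; rewrite mulr2n; lra.
by move=> /eqP; rewrite mulf_eq0 (gt_eqF (addr_gt0 cos_gt0 ltr01)) orbF subr_eq0 => /eqP.
Qed.

Lemma sqr_sin_pi3 : sin (pi / 3) ^+ 2 = 3 / 4 :> R.
Proof. by rewrite sin2cos2 cos_pi3; field. Qed.

Definition hexagon_x : seq R :=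
  [:: 0; 1; 2^-1; - 2^-1; - 1; - 2^-1; 2^-1].

(** [sin (pi / 3)] stays symbolic: only its square, [3 / 4], is ever used. *)
Definition hexagon_y : seq R :=
  let s := sin (pi / 3) in [:: 0; 0; s; s; 0; - s; - s].

Lemma d2q7_velocityE e (i : 'I_7) :
  d2q7_velocity e i = e *: \row_(k < 2) (if k == 0 then hexagon_x`_i else hexagon_y`_i).
Proof.
have e2 : 2 * pi / 3 = (pi / 3) *+ 2 :> R by field.
have e3 : 3 * pi / 3 = pi :> R by field.
have e4 : 4 * pi / 3 = pi / 3 + pi :> R by field.
have e5 : 5 * pi / 3 = (pi / 3) *+ 2 + pi :> R by field.
rewrite /d2q7_velocity /hexagon_x /hexagon_y.
(* [cospi] and [sinpi] come before the duplication formulas, which would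
   otherwise match [pi] itself, defined as [_ *+ 2]. *)
case: i => [[|[|[|[|[|[|[|//]]]]]]] lti] /=; apply/rowP => k;
  rewrite ?eqE /= !mxE; case: ifP => _ /=;
  rewrite ?mul0r ?mul1r ?e2 ?e3 ?e4 ?e5 ?cosDpi ?sinDpi ?cospi ?sinpi
    ?cos_mulr2n ?sin_mulr2n ?cos0 ?sin0 ?cos_pi3; by field.
Qed.

(* Besides the three conserved moments: an isotropic mode, and the values of
   Re z^2, Im z^2 and Re z^3 at the vertices of the hexagon. *)
Definition d2q7_modes c : 'M[R]_7 :=
  let s := sin (pi / 3) in
  \matrix_(k < 7, i < 7) (nth [::] [::
    [:: 1; 1; 1; 1; 1; 1; 1];
    hexagon_x;
    hexagon_y;
    [:: 2 * c; 2 * c - 1; 2 * c - 1; 2 * c - 1; 2 * c - 1; 2 * c - 1; 2 * c - 1];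
    [:: 0; 1; - 2^-1; - 2^-1; 1; - 2^-1; - 2^-1];
    [:: 0; 0; s; - s; 0; s; - s];
    [:: 0; 1; - 1; 1; - 1; 1; - 1]] k)`_i.

Definition d2q7_weights c : 'rV[R]_7 :=
  \row_(i < 7) (if i == 0 then 1 - 2 * c else c / 3).

(** These are squared norms for the weights. For [c > 0] the fourth is positive only if
    [2 * c < 1]. *)
Definition d2q7_mode_norms c : 'rV[R]_7 :=
  \row_(k < 7) [:: 1; c; c; 2 * c * (1 - 2 * c); c; c; 2 * c]`_k.

Lemma d2q7_modes_orthogonal c :
  d2q7_modes c *m diag_mx (d2q7_weights c) *m (d2q7_modes c)^T =
  diag_mx (d2q7_mode_norms c).
Proof.
have hs := sqr_sin_pi3; rewrite expr2 in hs.
apply/matrixP => k l; rewrite mul_mx_diag !mxE.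
rewrite !big_ord_recl big_ord0 !mxE /= /hexagon_x /hexagon_y.
move: (sin _) hs => s hs.
(* [lra] is linear in monomials, so the value of [s * s] is supplied times [c], as it occurs: the
   moving populations all carry the weight [c / 3]. *)
have hcs : c * (s * s) = c * (3 / 4) by rewrite hs.
case: k => [[|[|[|[|[|[|[|//]]]]]]] ltk]; case: l => [[|[|[|[|[|[|[|//]]]]]]] ltl];
  rewrite /= ?eqE /= ?mulr0n ?mulr1n; clear -hcs; lra.
Qed.

End HexagonalLattice.

(** * Linearization at the rest state *)

Section RestState.
Context {R : realType}.
Context (e g tau hbar : R) (e_gt0 : 0 < e) (hbar_gt0 : 0 < hbar).
Implicit Types (f v : 'rV[R]_7).

Let fs := d2q7_equilibrium e g hbar 0.
Let c := g * hbar / e ^+ 2.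
Let momentum f (k : 'I_2) := \sum_(i < 7) f 0 i * d2q7_velocity e i 0 k.
Let w i := d2q7_weights c 0 i.

Let e_neq0 : e != 0. Proof. exact: lt0r_neq0. Qed.
Let hbar_neq0 : hbar != 0. Proof. exact: lt0r_neq0. Qed.

Lemma rest_stateE i :
  fs 0 i = if i == 0 then hbar - g * hbar ^+ 2 / e ^+ 2
           else g * hbar ^+ 2 / (6 * e ^+ 2).
Proof.
have dot0 (u : 'rV[R]_2) : dotv u 0 = 0.
  by rewrite /dotv big1// => k _; rewrite mxE mulr0.
by rewrite mxE !dot0; case: ifP => _; rewrite ?expr0n /= ?mulr0 ?mul0r ?subr0 ?addr0.
Qed.

Lemma water_depth_rest : water_depth fs = hbar.
Proof.
rewrite /water_depth; under eq_bigr do rewrite rest_stateE.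
by rewrite !big_ord_recl big_ord0 /=; field.
Qed.

Lemma water_velocity_rest : water_velocity e fs = 0.
Proof.
rewrite /water_velocity water_depth_rest.
under eq_bigr do rewrite rest_stateE d2q7_velocityE.
rewrite !big_ord_recl big_ord0 /= /hexagon_x /hexagon_y.
by apply/rowP => k; rewrite !mxE; case: ifP => _ /=; field; rewrite e_neq0.
Qed.

Lemma d2q7_collision_rest : d2q7_collision e g tau fs = 0.
Proof.
by rewrite /d2q7_collision water_depth_rest water_velocity_rest subrr scaler0.
Qed.

Lemma is_diff_momentum f k : is_diff f (momentum ^~ k) (momentum ^~ k).
Proof.
have -> : momentum ^~ k =
    \sum_(i < 7) (d2q7_velocity e i 0 k *: (fun f : 'rV[R]_7 => f 0 i : R)).
  apply/funext => y; rewrite fct_sumE; apply: eq_bigr => i _.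
  exact: mulrC.
by apply: is_diff_sum => i; exact/is_diffZ/is_diff_coord.
Qed.

Lemma is_diff_water_depth f : is_diff f (@water_depth R) (@water_depth R).
Proof.
have -> : @water_depth R = \sum_(i < 7) (fun f : 'rV[R]_7 => f 0 i : R).
  by apply/funext => y; rewrite fct_sumE.
by apply: is_diff_sum => i; exact: is_diff_coord.
Qed.

Lemma water_velocity_coord f k :
  water_velocity e f 0 k = (water_depth f)^-1 * momentum f k.
Proof. by rewrite mxE summxE; under eq_bigr do rewrite mxE. Qed.

(** The momentum vanishes at rest, which kills the product-rule term coming from the inverse
    depth. *)
Lemma is_diff_water_velocity_rest k :
  is_diff fs (fun f => water_velocity e f 0 k : R) (fun v => hbar^-1 * momentum v k).
Proof.
have -> : (fun f => water_velocity e f 0 k) =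
          (fun f => (water_depth f)^-1) * (momentum ^~ k).
  by apply/funext => f; rewrite water_velocity_coord.
have mom0 : momentum fs k = 0.
  have := water_velocity_coord fs k; rewrite water_velocity_rest mxE.
  move/esym/eqP; rewrite mulf_eq0 invr_eq0 water_depth_rest (negbTE hbar_neq0).
  by move/eqP.
have depth_neq0 : water_depth fs != 0 by rewrite water_depth_rest.
apply: (is_diff_eq (is_diffM (is_diff_inv (is_diff_water_depth fs) depth_neq0)
                             (is_diff_momentum fs k))).
by apply/funext => v; rewrite !fctE mom0 scale0r addr0 water_depth_rest.
Qed.

Lemma is_diff_equilibrium_rest i :
  is_diff fs
    (fun f => d2q7_equilibrium e g (water_depth f) (water_velocity e f) 0 i : R)
    (fun v => w i * water_depth v + (3 * e ^+ 2)^-1 *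
       (d2q7_velocity e i 0 0 * momentum v 0 + d2q7_velocity e i 0 1 * momentum v 1)).
Proof.
have u0 k : water_velocity e fs 0 k = 0 by rewrite water_velocity_rest mxE.
pose x0 := d2q7_velocity e i 0 0; pose x1 := d2q7_velocity e i 0 1.
have dsw a b c0 c1 p q r := is_diff_shallow_water a b c0 c1 p q r
  (is_diff_water_depth fs) (is_diff_water_velocity_rest 0)
  (is_diff_water_velocity_rest 1) (u0 0) (u0 1).
have dotE (u v : 'rV[R]_2) : dotv u v = u 0 0 * v 0 0 + u 0 1 * v 0 1.
  by rewrite /dotv big_ord_recl big_ord1; congr (_ + u 0 _ * v 0 _); apply/val_inj.
have [i0|i0] := eqVneq i 0.
  (* Rest population: the depth coefficient is [1 - 2 * g * hbar / e ^+ 2 = 1 - 2 * c]. *)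
  have := dsw 1 (- g / e ^+ 2) 0 0 (e ^- 2) 0 (e ^- 2).
  rewrite water_depth_rest; set F := (F in is_diff _ F _) => dF.
  rewrite (_ : (fun f => _) = F); last first.
    by apply/funext => f; rewrite mxE i0 eqxx dotE /F; field.
  apply: (is_diff_eq dF); apply/funext => v.
  by rewrite /w !mxE i0 /d2q7_velocity eqxx !mxE /c; field; rewrite e_neq0.
(* Moving populations: expanding [(xi_i . u)^2] doubles the cross term. The depth coefficient is
   [2 * g * hbar / (6 * e ^+ 2) = c / 3], and the factor [hbar] cancels the [hbar^-1] in the
   differential of the velocity. *)
have := dsw 0 (g / (6 * e ^+ 2)) (x0 / (3 * e ^+ 2)) (x1 / (3 * e ^+ 2))
  (2 * x0 ^+ 2 / (3 * e ^+ 4) - (2 * e ^+ 2)^-1) (4 * (x0 * x1) / (3 * e ^+ 4))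
  (2 * x1 ^+ 2 / (3 * e ^+ 4) - (2 * e ^+ 2)^-1).
rewrite water_depth_rest; set F := (F in is_diff _ F _) => dF.
rewrite (_ : (fun f => _) = F); last first.
  by apply/funext => f; rewrite mxE (negbTE i0) !dotE /F -/x0 -/x1; field.
apply: (is_diff_eq dF); apply/funext => v.
rewrite /w mxE (negbTE i0) -/x0 -/x1 /c; field.
by rewrite e_neq0.
Qed.

Lemma is_diff_collision_rest :
  is_diff fs (d2q7_collision e g tau) (fun v => \row_(i < 7) (tau^-1 *
    (w i * water_depth v + (3 * e ^+ 2)^-1 *
       (d2q7_velocity e i 0 0 * momentum v 0 + d2q7_velocity e i 0 1 * momentum v 1)
     - v 0 i))).
Proof.
apply: is_diff_row => i.
have := is_diffZ tau^-1 (is_diffB (is_diff_equilibrium_rest i) (is_diff_coord fs i)).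
set F := (F in is_diff _ F _) => dF.
rewrite (_ : (fun f => _) = F); last first.
  by apply/funext => f; rewrite [LHS]mxE [X in _ * X]mxE [X in _ * (_ + X)]mxE.
by apply: (is_diff_eq dF); apply/funext => v; rewrite mxE.
Qed.

Lemma jacobian_collision_rest :
  jacobian_matrix (d2q7_collision e g tau) fs = tau^-1 *: \matrix_(i, j)
    (w i + (3 * e ^+ 2)^-1 * (d2q7_velocity e i 0 0 * d2q7_velocity e j 0 0
                              + d2q7_velocity e i 0 1 * d2q7_velocity e j 0 1)
     - (i == j)%:R).
Proof.
(* Column [j] of the Jacobian is the differential at the basis vector [delta_mx 0 j]. *)
have depth_delta j : water_depth (delta_mx 0 j) = 1 :> R.
  rewrite /water_depth (bigD1 j)//= mxE !eqxx big1 ?addr0// => i ij.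
  by rewrite mxE eqxx (negbTE ij).
have momentum_delta j k : momentum (delta_mx 0 j) k = d2q7_velocity e j 0 k.
  rewrite /momentum (bigD1 j)//= mxE !eqxx mul1r big1 ?addr0// => i ij.
  by rewrite mxE eqxx (negbTE ij) mul0r.
have dcoll := is_diff_collision_rest.
apply/matrixP => i j; rewrite !mxE diff_val mxE depth_delta !momentum_delta mulr1.
by rewrite mxE eqxx.
Qed.

End RestState.

(** Acting on row vectors, the equilibrium part projects onto the three conserved modes,
    orthogonally for the weights; [1], [c^-1], [c^-1] are the inverses of their squared norms. *)
Lemma jacobian_collision_rest_modes {R : realType} (e g tau hbar c : R) :
  0 < e -> 0 < hbar -> 0 < c -> c = g * hbar / e ^+ 2 ->
  jacobian_matrix (d2q7_collision e g tau) (d2q7_equilibrium e g hbar 0) =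
  tau^-1 *: (diag_mx (d2q7_weights c) *m (d2q7_modes c)^T
    *m diag_mx (\row_k [:: 1; c^-1; c^-1; 0; 0; 0; 0]`_k) *m d2q7_modes c - 1%:M).
Proof.
move=> e_gt0 hbar_gt0 c_gt0 cE; rewrite jacobian_collision_rest// -cE.
congr (_ *: _); apply/matrixP => i j; rewrite !mxE; congr (_ - _).
have ones (k : 'I_7) : [:: 1; 1; 1; 1; 1; 1; 1]`_k = 1 :> R.
  by case: k => [[|[|[|[|[|[|[|//]]]]]]] ltk].
rewrite !d2q7_velocityE !big_ord_recl big_ord0 mul_mx_diag mul_diag_mx.
rewrite !mxE /= !ones.
have [->|_] := eqVneq i 0; rewrite /= ?eqxx /=.
  by rewrite /hexagon_x /hexagon_y /=; field; rewrite !gt_eqF.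
rewrite !(mulr0, mul0r, addr0).
set xi := hexagon_x`_i; set xj := hexagon_x`_j.
set yi := hexagon_y`_i; set yj := hexagon_y`_j.
by field; rewrite !gt_eqF.
Qed.

Theorem proposition1 (R : realType) (e tau hbar g : R)
    (he : 0 < e) (htau : 0 < tau) (hh : 0 < hbar) (hg : 0 < g)
    (hstab : g < e ^+ 2 / (2 * hbar)) :
  stable_at (d2q7 e g tau) (d2q7_equilibrium e g hbar 0).
Proof.
(* Only the equation of [c] is kept, so that [field] treats [c] as a variable. *)
have [c cE] : exists c : R, c = g * hbar / e ^+ 2 by eexists.
have c_gt0 : 0 < c by rewrite cE divr_gt0 ?mulr_gt0 ?exprn_gt0.
have c_lt : 0 < 1 - 2 * c.
  rewrite ltr_pdivlMr ?mulr_gt0// in hstab.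
  rewrite subr_gt0 cE mulrA ltr_pdivrMr ?exprn_gt0// mul1r.
  by rewrite mulrCA in hstab.
split => /=; first exact: d2q7_collision_rest.
  by have [] := is_diff_collision_rest e g tau hbar he hh.
(* The [d + 1 = 3] conserved modes come first and do not relax; the others relax at rate
   [tau^-1]. *)
pose lam : 'rV[R]_7 := \row_(k < 7) (if (k < 3)%N then 0 else tau^-1).
have w_gt0 i : 0 < d2q7_weights c 0 i.
  by rewrite mxE; case: ifP => // _; rewrite divr_gt0.
have n_gt0 k : 0 < d2q7_mode_norms c 0 k.
  have c2_gt0 : 0 < 2 * c by rewrite mulr_gt0.
  by rewrite mxE; case: k => [[|[|[|[|[|[|[|//]]]]]]] ltk]; rewrite /= ?mulr_gt0.
have BJ : d2q7_modes c *m
    jacobian_matrix (d2q7_collision e g tau) (d2q7_equilibrium e g hbar 0) =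
    - diag_mx lam *m d2q7_modes c.
  (* Orthogonality reduces the equilibrium part to a diagonal factor, [1] on the conserved modes and
     [0] on the others; subtracting [1] and dividing by [tau] leaves [- lam]. *)
  rewrite (jacobian_collision_rest_modes _ _ tau _ _ he hh c_gt0 cE).
  rewrite -scalemxAr mulmxBr mulmx1 !mulmxA d2q7_modes_orthogonal mulmx_diag.
  apply/matrixP => k i; rewrite mulNmx mxE [X in _ * X]mxE !mul_diag_mx.
  rewrite !mxE.
  have [c_neq0 tau_neq0] := (lt0r_neq0 c_gt0, lt0r_neq0 htau).
  by case: k => [[|[|[|[|[|[|[|//]]]]]]] ltk] /=; field; rewrite ?c_neq0.
have [P [a [Punit PtP PJ]]] :=
  orthogonal_modes_symmetrizer _ _ _ _ _ w_gt0 n_gt0 (d2q7_modes_orthogonal c) BJ.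
exists P, a, lam; split => // k; rewrite mxE.
  by move=> ->.
by rewrite leqNgt => /negbTE ->; rewrite invr_gt0.
Qed.
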